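(* Let $p>3$ be prime, $b,c\in\mathbb{Q}$, and assume $h(x)=x^{2p}+bx^p+c^p$ is irreducible over $\mathbb{Q}$. Let $\Delta=b^2-4c^p$. Working in a fixed algebraic closure of $\mathbb{Q}$, let $\alpha$ be a root of $x^2+bx+c^p$, choose $\beta$ with $\beta^p=\alpha$, put $\beta_1=c/\beta$, let $\zeta_p$ be a primitive $p$th root of unity, and let $D_0=\mathbb{Q}(\beta+\beta_1)$. Then the splitting field $L$ of $d_h(x)=D_p(x,c)+b$ over $\mathbb{Q}$ is $L=D_0\big(\zeta_p+\zeta_p^{-1},\ \sqrt{\Delta}(\zeta_p-\zeta_p^{-1})\big)$.
   Context: The Dickson polynomials of the first kind are defined by $D_1(t,n)=t$, $D_2(t,n)=t^2-2n$, $D_k(t,n)=tD_{k-1}(t,n)-nD_{k-2}(t,n)$ for $k>2$. *)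

(* Defs.v *)
From HB Require Import structures.
From mathcomp Require Import all_boot all_order all_algebra all_field.
From mathcomp Require Import boolp classical_sets.

Set Implicit Arguments.
Unset Strict Implicit.
Unset Printing Implicit Defensive.

Import GRing.Theory.
Local Open Scope classical_set_scope.
Local Open Scope ring_scope.

(* Dickson polynomials of the first kind are defined for k >= 1; index 0
   carries the usual convention 2, which is consistent with the recurrence. *)
Fixpoint dickson (R : comNzRingType) (k : nat) (t n : R) : R :=
  match k with
  | 0 => 2%:R
  | 1 => t
  | 2 => t ^+ 2 - 2%:R * n
  | (k''.+1 as k').+1 => t * dickson k' t n - n * dickson k'' t n
  end.

(* For E a subset of a field, [divring_closed] (contains 1, closed under
   subtraction and division, with x / 0 = 0) says that E is a subfield. *)
Definition adjoin (F : fieldType) (K S : set F) : set F :=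
  smallest (fun E : set F => divring_closed [in E]) (K `|` S).

(* The splitting field over k of p, inside an algebraically closed extension F
   of k (so that p splits in F): k is adjoined all the roots of p. *)
Definition splitting_field (k : fieldType) (F : closedFieldType)
    (iota : {rmorphism k -> F}) (p : {poly k}) : set F :=
  adjoin (range iota) [set z | root (map_poly iota p) z].

(* Main.v *)
Require Import Defs.
From HB Require Import structures.
From mathcomp Require Import all_boot all_order all_algebra all_field.
From mathcomp Require Import boolp classical_sets.
From mathcomp Require Import ring.

Set Implicit Arguments.
Unset Strict Implicit.
Unset Printing Implicit Defensive.

Import GRing.Theory.
Local Open Scope classical_set_scope.
Local Open Scope ring_scope.

(** Since [D_p(y + c/y, c) = y^p + (c/y)^p], the roots of [d_h] are the numbers
    [theta_k = beta zeta^k + beta1 zeta^-k].  They satisfy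
    [theta_1 + theta_(-1) = theta_0 (zeta + zeta^-1)] and
    [theta_1 - theta_(-1) = (beta - beta1) (zeta - zeta^-1)], where
    [(beta - beta1) S = beta^p - beta1^p = +- sqrt Delta] for some
    [S] in [Q(theta_0)], because the quotient is symmetric in [beta, beta1] and
    [beta beta1 = c].  Irreducibility of [h] gives [c != 0], [Delta != 0] (hence
    [S != 0]) and [theta_0 != 0], so each side can be solved for the other; the
    remaining [theta_k] follow from
    [theta_(k+1) + theta_(k-1) = theta_k (zeta + zeta^-1)]. *)

(** * Subfields as sets *)

Lemma subfieldB (F : fieldType) (E : set F) (x y : F) :
  divring_closed [in E] -> E x -> E y -> E (x - y).
Proof. by case=> _ EB _ Ex Ey; apply/set_mem/EB; apply/mem_set. Qed.

Lemma subfield_div (F : fieldType) (E : set F) (x y : F) :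
  divring_closed [in E] -> E x -> E y -> E (x / y).
Proof. by case=> _ _ EV Ex Ey; apply/set_mem/EV; apply/mem_set. Qed.

Lemma subfield1 (F : fieldType) (E : set F) : divring_closed [in E] -> E 1.
Proof. by case=> /set_mem. Qed.

Lemma subfield0 (F : fieldType) (E : set F) : divring_closed [in E] -> E 0.
Proof.
by move=> fE; rewrite -(subrr 1); apply: subfieldB => //; apply: subfield1.
Qed.

Lemma subfieldD (F : fieldType) (E : set F) (x y : F) :
  divring_closed [in E] -> E x -> E y -> E (x + y).
Proof.
move=> fE Ex Ey; rewrite -[y]opprK -[- y]sub0r.
by do 2![apply: subfieldB => //]; apply: subfield0.
Qed.

Lemma subfieldM (F : fieldType) (E : set F) (x y : F) :
  divring_closed [in E] -> E x -> E y -> E (x * y).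
Proof.
move=> fE Ex Ey; rewrite -[y]invrK -[y^-1]mul1r.
by do 2![apply: subfield_div => //]; apply: subfield1.
Qed.

Lemma adjoin_subfield (F : fieldType) (K S : set F) :
  divring_closed [in adjoin K S].
Proof.
split; first by apply/mem_set => E [fE _]; apply: subfield1.
- move=> x y /set_mem Ax /set_mem Ay; apply/mem_set => E /[dup] hE [fE _].
  by apply: subfieldB => //; [apply: Ax | apply: Ay].
- move=> x y /set_mem Ax /set_mem Ay; apply/mem_set => E /[dup] hE [fE _].
  by apply: subfield_div => //; [apply: Ax | apply: Ay].
Qed.

Lemma adjoin_base (F : fieldType) (K S : set F) : K `<=` adjoin K S.
Proof. by apply: sub_smallest => x; left. Qed.

Lemma adjoin_gen (F : fieldType) (K S : set F) : S `<=` adjoin K S.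
Proof. by apply: sub_smallest => x; right. Qed.

Lemma adjoin_sub (F : fieldType) (K S E : set F) :
  divring_closed [in E] -> K `<=` E -> S `<=` E -> adjoin K S `<=` E.
Proof.
by move=> fE KE SE; apply: smallest_sub => // x []; [apply: KE | apply: SE].
Qed.

Lemma nat_ind2 (P : nat -> Prop) :
  P 0%N -> P 1%N -> (forall k, P k -> P k.+1 -> P k.+2) -> forall k, P k.
Proof.
move=> P0 P1 PS k; suff [] : P k /\ P k.+1 by [].
by elim: k => // k [Pk Pk1]; split=> //; apply: PS.
Qed.

(** The quotient of [x ^+ k - y ^+ k] by [x - y] is symmetric, hence a polynomial in [x + y] and
    [x * y]; a two-step recurrence in [k] builds it without dividing, so [x = y] needs no separate
    case. *)
Lemma subXX_subfield (F : fieldType) (E : set F) (x y : F) (k : nat) :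
  divring_closed [in E] -> E (x + y) -> E (x * y) ->
  exists2 s, E s & x ^+ k - y ^+ k = (x - y) * s.
Proof.
move=> fE Es Ep; elim/nat_ind2: k => [||k [s Ek eqk] [s1 Ek1 eqk1]].
- by exists 0; [apply: subfield0 | ring].
- by exists 1; [apply: subfield1 | ring].
exists ((x + y) * s1 - x * y * s).
  by apply: subfieldB => //; apply: subfieldM.
have -> : x ^+ k.+2 - y ^+ k.+2 =
    (x + y) * (x ^+ k.+1 - y ^+ k.+1) - x * y * (x ^+ k - y ^+ k).
  by rewrite !exprS; ring.
by rewrite eqk eqk1; ring.
Qed.

(** As a function of [k] the sum obeys the linear recurrence with characteristic roots [z] and
    [z^-1], whose coefficients are [z + z^-1] and [-1], so its first two terms determine the
    rest. *)
Lemma twisted_sum_subfield (F : fieldType) (E : set F) (x y z : F) (k : nat) :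
  divring_closed [in E] -> z != 0 ->
  E (x + y) -> E (z + z^-1) -> E (x * z + y / z) ->
  E (x * z ^+ k + y / z ^+ k).
Proof.
move=> fE z0 E0 Ez E1; elim/nat_ind2: k => [||k Ek Ek1].
- by rewrite expr0 invr1 !mulr1.
- by rewrite expr1.
have -> : x * z ^+ k.+2 + y / z ^+ k.+2 =
    (x * z ^+ k.+1 + y / z ^+ k.+1) * (z + z^-1) - (x * z ^+ k + y / z ^+ k).
  by rewrite !exprS; field; rewrite z0 expf_neq0.
by apply: subfieldB => //; apply: subfieldM.
Qed.

(** * Dickson polynomials *)

Lemma dickson_rec (R : comNzRingType) (k : nat) (t n : R) :
  dickson k.+2 t n = t * dickson k.+1 t n - n * dickson k t n.
Proof. by case: k => [|k] //=; ring. Qed.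

Lemma rmorph_dickson (R S : comNzRingType) (f : {rmorphism R -> S})
    (k : nat) (t n : R) :
  f (dickson k t n) = dickson k (f t) (f n).
Proof.
elim/nat_ind2: k => [||k IHk IHk1] //; first by rewrite /= rmorph_nat.
by rewrite !dickson_rec rmorphB !rmorphM IHk IHk1.
Qed.

Lemma dickson_sum (R : comNzRingType) (k : nat) (x y : R) :
  dickson k (x + y) (x * y) = x ^+ k + y ^+ k.
Proof.
elim/nat_ind2: k => [||k IHk IHk1] //.
by rewrite dickson_rec IHk IHk1 !exprS; ring.
Qed.

Lemma root_dickson (k F : fieldType) (iota : {rmorphism k -> F})
    (p : nat) (b c : k) (z : F) :
  root (map_poly iota (dickson p 'X c%:P + b%:P)) z =
  (dickson p z (iota c) == - iota b).
Proof.
rewrite rootE rmorphD /= map_polyC /= hornerD hornerC addr_eq0.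
by rewrite (rmorph_dickson (map_poly iota)) /= map_polyX map_polyC -horner_evalE
           (rmorph_dickson (horner_eval z)) /= !horner_evalE hornerX hornerC.
Qed.

Lemma closed_sum_prod (F : closedFieldType) (s n : F) :
  exists x y : F, s = x + y /\ n = x * y.
Proof.
(* The coefficients encode [x ^+ 2 = - n + s * x], so [x] is a root of [X^2 - s X + n]. *)
have [x] := @solve_monicpoly F 2 (fun i => if i == 0%N then - n else s) isT.
rewrite !big_ord_recl big_ord0 /= /bump /= => eqx.
exists x, (s - x); split; first by ring.
by rewrite mulrBr -expr2 eqx; ring.
Qed.

Lemma eq_expn_prim_root (F : fieldType) (p : nat) (zeta x y : F) :
  p.-primitive_root zeta -> y != 0 -> x ^+ p = y ^+ p ->
  exists k, x = y * zeta ^+ k.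
Proof.
move=> zetaP y0 eqp.
have [|k eqk] := @prim_rootP _ _ _ zetaP (x / y).
  by rewrite expr_div_n eqp divff // expf_neq0.
by exists k; rewrite -eqk mulrC divfK.
Qed.

(** Write [z = u + v] with [u * v = iota c]: being a root becomes
    [u ^+ p + v ^+ p = x ^+ p + y ^+ p]. The products of these powers agree too, so [u ^+ p] or
    [v ^+ p] is [x ^+ p]; this fixes that summand up to a power of [zeta], and the other by the
    product. *)
Lemma root_dickson_twisted (k : fieldType) (F : closedFieldType)
    (iota : {rmorphism k -> F}) (p : nat) (b c : k) (zeta x y z : F) :
  p.-primitive_root zeta -> x != 0 -> y != 0 -> x * y = iota c ->
  x ^+ p + y ^+ p = - iota b ->
  root (map_poly iota (dickson p 'X c%:P + b%:P)) z <->
  exists j, z = x * zeta ^+ j + y / zeta ^+ j.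
Proof.
move=> zetaP x0 y0 xy xyp.
have zp : zeta ^+ p = 1 := prim_expr_order zetaP.
have z0 : zeta != 0.
  by rewrite (prim_root_eq0 zetaP) -lt0n (prim_order_gt0 zetaP).
rewrite root_dickson; split=> [/eqP|[j ->]].
  have [u [v [-> uv]]] := closed_sum_prod z (iota c).
  rewrite uv dickson_sum -xyp => uvp.
  have twist s t : s * t = x * y -> s ^+ p = x ^+ p ->
      exists j, s + t = x * zeta ^+ j + y / zeta ^+ j.
    move=> st /(eq_expn_prim_root zetaP x0) [j eqs].
    exists j; rewrite -eqs; congr (_ + _).
    have zj : zeta ^+ j != 0 by rewrite expf_neq0.
    apply: (mulfI x0); rewrite mulrA -st eqs; field.
    exact: zj.
  (* The quadratic with roots [u ^+ p] and [v ^+ p] vanishes at [x ^+ p]. *)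
  have : (u ^+ p - x ^+ p) * (v ^+ p - x ^+ p) = 0.
    have -> : (u ^+ p - x ^+ p) * (v ^+ p - x ^+ p) =
       (u * v) ^+ p - x ^+ p * (u ^+ p + v ^+ p) + x ^+ p * x ^+ p.
      by rewrite exprMn; ring.
    by rewrite uvp -uv -xy exprMn; ring.
  move/eqP; rewrite mulf_eq0 !subr_eq0 => /orP[] /eqP.
    by apply: twist; rewrite xy.
  by rewrite addrC; apply: twist; rewrite mulrC xy.
have -> : iota c = (x * zeta ^+ j) * (y / zeta ^+ j).
  by rewrite -xy; field; rewrite expf_neq0.
rewrite dickson_sum exprMn expr_div_n -!exprM mulnC exprM zp expr1n.
by rewrite mulr1 divr1 xyp.
Qed.

(** * Consequences of the irreducibility of h *)

Lemma irreducible_size (k : fieldType) (f q : {poly k}) :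
  irreducible_poly f -> q %| f -> (1 < size q)%N -> size q = size f.
Proof. by move=> [_ irr] qf q1; apply/eqp_size/irr => //; rewrite gtn_eqF. Qed.

Lemma size_trinomial (k : fieldType) (p : nat) (b c : k) :
  (0 < p)%N -> size ('X^(2 * p) + b *: 'X^p + c%:P) = (2 * p).+1.
Proof.
move=> p0; have lt2p : (p.+1 < (2 * p).+1)%N.
  by rewrite mul2n -addnn ltnS -ltn_psubLR ?subnn.
rewrite -addrA size_polyDl size_polyXn //.
apply: leq_ltn_trans lt2p; apply: leq_trans (size_polyD _ _) _.
rewrite geq_max (leq_trans (size_scale_leq _ _)) ?size_polyXn //.
by rewrite (leq_trans (size_polyC_leq1 _)).
Qed.

(** With [c = 0], ['X^p] would be a proper factor. *)
Lemma trinomial_irreducible_const_neq0 (k : fieldType) (p : nat) (b c : k) :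
  (0 < p)%N -> irreducible_poly ('X^(2 * p) + b *: 'X^p + c%:P) -> c != 0.
Proof.
move=> p0 irr; apply/eqP => c0.
have /(irreducible_size irr) :
    'X^p %| 'X^(2 * p) + b *: 'X^p + c%:P.
  rewrite c0 polyC0 addr0 mul2n -addnn exprD -mul_polyC -mulrDl.
  exact: dvdp_mull.
rewrite size_polyXn size_trinomial // ltnS => /(_ p0) [] /eqP.
by rewrite -[X in X == _]mul1n eqn_pmul2r.
Qed.

(** A zero discriminant would make the trinomial the square of ['X^p + b / 2]. *)
Lemma trinomial_irreducible_discr_neq0 (k : fieldType) (p : nat) (b c : k) :
  (0 < p)%N -> 2%:R != 0 :> k ->
  irreducible_poly ('X^(2 * p) + b *: 'X^p + c%:P) -> b ^+ 2 - 4%:R * c != 0.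
Proof.
move=> p0 two0 irr; apply/eqP => /eqP; rewrite subr_eq0 => /eqP discr0.
have [d eqb] : exists d, b = d + d by exists (b / 2%:R); field.
have /(irreducible_size irr) :
    'X^p + d%:P %| 'X^(2 * p) + b *: 'X^p + c%:P.
  have -> : c = d * d.
    apply: (mulfI (x := 4%:R)); first by rewrite (natrM _ 2 2) mulf_neq0.
    by rewrite -discr0 eqb; ring.
  rewrite eqb polyCM mul2n -addnn exprD -mul_polyC polyCD.
  have -> : 'X^p * 'X^p + (d%:P + d%:P) * 'X^p + d%:P * d%:P =
            ('X^p + d%:P) * ('X^p + d%:P) by ring.
  exact: dvdp_mull.
rewrite size_XnaddC // size_trinomial // ltnS => /(_ p0) [] /eqP.
by rewrite -[X in X == _]mul1n eqn_pmul2r.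
Qed.

(** With [b = 0] the trinomial is a sum of two odd [p]-th powers, of ['X^2] and of [c], so
    ['X^2 + c] would be a proper factor. *)
Lemma trinomial_irreducible_middle_neq0 (k : fieldType) (p : nat) (b c : k) :
  odd p -> (1 < p)%N ->
  irreducible_poly ('X^(2 * p) + b *: 'X^p + (c ^+ p)%:P) -> b != 0.
Proof.
move=> p_odd p1 irr; apply/eqP => b0.
have p0 : (0 < p)%N by apply: ltnW.
have /(irreducible_size irr) :
    'X^2 + c%:P %| 'X^(2 * p) + b *: 'X^p + (c ^+ p)%:P.
  rewrite b0 scale0r addr0 exprM rmorphXn /=.
  have -> : ('X^2) ^+ p + c%:P ^+ p = ('X^2) ^+ p - (- c%:P) ^+ p :> {poly k}.
    by rewrite exprNn -signr_odd p_odd expr1 mulN1r opprK.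
  by rewrite subrXX opprK dvdp_mulr.
rewrite size_XnaddC // size_trinomial // => /(_ isT) [] /eqP.
by rewrite -[X in X == _]muln1 eqn_pmul2l // ltn_eqF.
Qed.

(** * Equality of the two fields, by double inclusion *)

Unset Implicit Arguments.

Theorem theorem5p2
  (Qbar : closedFieldType) (iota : {rmorphism rat -> Qbar})
  (Qbar_algebraic : forall x : Qbar, algebraicOver iota x)
  (p : nat) (p_prime : prime p) (p_gt3 : (3 < p)%N)
  (b c : rat)
  (h_irreducible :
     irreducible_poly ('X^(2 * p) + b *: 'X^p + (c ^+ p)%:P : {poly rat}))
  (alpha beta zeta sqrtDelta : Qbar)
  (alpha_root :
     root (map_poly iota ('X^2 + b *: 'X + (c ^+ p)%:P)) alpha)
  (beta_pow : beta ^+ p = alpha)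
  (zeta_prim : p.-primitive_root zeta)
  (sqrtDelta_sq : sqrtDelta ^+ 2 = iota (b ^+ 2 - 4%:R * c ^+ p)) :
  let beta1 := iota c / beta in
  let D0 := adjoin (range iota) [set beta + beta1] in
  let d_h : {poly rat} := dickson p 'X c%:P + b%:P in
  splitting_field iota d_h =
    adjoin D0 [set zeta + zeta^-1; sqrtDelta * (zeta - zeta^-1)].
Proof.
move=> beta1 D0 d_h; have p0 : (0 < p)%N := prime_gt0 p_prime.
have p1 : (1 < p)%N := prime_gt1 p_prime.
have p_odd : odd p.
  by case: (even_prime p_prime) p_gt3 => // ->.
have b0 := trinomial_irreducible_middle_neq0 p_odd p1 h_irreducible.
have rat_two0 : 2%:R != 0 :> rat by [].
have discr0 :=
  trinomial_irreducible_discr_neq0 p0 rat_two0 h_irreducible.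
have := trinomial_irreducible_const_neq0 p0 h_irreducible.
rewrite expf_eq0 p0 /= => c0.
have {b0}ib0 : iota b != 0 by rewrite fmorph_eq0.
have {c0}ic0 : iota c != 0 by rewrite fmorph_eq0.
have two0 : 2%:R != 0 :> Qbar by rewrite -(rmorph_nat iota) fmorph_eq0.
have z0 : zeta != 0.
  by rewrite (prim_root_eq0 zeta_prim) -lt0n.
have sqrtDelta0 : sqrtDelta != 0.
  by rewrite -sqrf_eq0 sqrtDelta_sq fmorph_eq0.
move: alpha_root; rewrite rootE !rmorphD /= map_polyXn map_polyZ map_polyX.
rewrite map_polyC /= !hornerE rmorphXn /= -beta_pow => quad.
have beta0 : beta != 0.
  apply: contraTneq quad => ->; rewrite expr0n gtn_eqF // mulr0n.
  by rewrite expr0n mulr0 !add0r expf_neq0.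
move/eqP: quad => quad.
have beta10 : beta1 != 0 by rewrite mulf_neq0 ?invr_eq0.
have bb1 : beta * beta1 = iota c by rewrite mulrC divfK.
clearbody beta1.
(* [beta1 ^+ p] is the other root of the quadratic of [alpha]; multiplying the sum by [beta ^+ p]
   recovers that quadratic. *)
have sum_pow : beta ^+ p + beta1 ^+ p = - iota b.
  apply/eqP; rewrite -addr_eq0; apply/eqP/(mulfI (expf_neq0 p beta0)).
  by rewrite mulr0 -quad -bb1 exprMn; ring.
(* The squared difference of the two roots is the discriminant, so it matches [sqrtDelta] only up to
   sign. *)
have sqrtDelta_eq : (beta ^+ p - beta1 ^+ p == sqrtDelta) ||
    (beta ^+ p - beta1 ^+ p == - sqrtDelta).
  rewrite -eqf_sqr sqrtDelta_sq rmorphB /= rmorphXn /=.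
  rewrite rmorphM /= rmorphXn /= rmorph_nat -bb1 exprMn -[iota b]opprK -sum_pow; apply/eqP.
  by ring.
(* For odd [p], [beta = - beta1] would give [beta ^+ p + beta1 ^+ p = 0], hence [b = 0]. *)
have theta0 : beta + beta1 != 0.
  apply: contra_neq ib0 => /eqP; rewrite addr_eq0 => /eqP beta_opp.
  apply/eqP; rewrite -oppr_eq0 -sum_pow beta_opp exprNn -signr_odd p_odd.
  by rewrite expr1 mulN1r addNr.
pose theta j := beta * zeta ^+ j + beta1 / zeta ^+ j.
have rootP z : root (map_poly iota d_h) z <-> exists j, z = theta j.
  exact: root_dickson_twisted.
(* The indices of [theta] are natural numbers, so [p.-1] stands in for -1. *)
have zetaV : zeta ^+ p.-1 = zeta^-1.
  apply: (mulfI z0); rewrite -exprS prednK // divff //.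
  exact: prim_expr_order.
(* Stated for any [E] because both inclusions use it: one divides by [s], the other multiplies by
   it. *)
have quotient_sqrtDelta E : divring_closed [in E] -> range iota `<=` E ->
    E (beta + beta1) ->
    exists2 s, E s & s != 0 /\ (beta - beta1) * s = sqrtDelta.
  move=> fE QE E0.
  have Ec : E (beta * beta1) by rewrite bb1; apply: QE; exists c.
  have [s Es eqs] := subXX_subfield p fE E0 Ec.
  have [t Et eqt] : exists2 t, E t & (beta - beta1) * t = sqrtDelta.
    case/orP: sqrtDelta_eq => /eqP eqD; first by exists s; rewrite // -eqs.
    (* The sign of the square root is absorbed into the witness. *)
    exists (0 - s); first by apply: subfieldB => //; apply: subfield0.
    by rewrite sub0r mulrN -eqs eqD opprK.
  exists t => //; split=> //; apply: contra_neq sqrtDelta0 => t0.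
  by rewrite -eqt t0 mulr0.
apply/seteqP; split.
  set E := adjoin D0 _.
  have fE : divring_closed [in E] by apply: adjoin_subfield.
  have D0E : D0 `<=` E := @adjoin_base _ _ _.
  have QE : range iota `<=` E.
    by apply: subset_trans D0E; apply: adjoin_base.
  have E0 : E (beta + beta1) by apply: D0E; apply: adjoin_gen.
  have Ez : E (zeta + zeta^-1) by apply: adjoin_gen; left.
  have EDz : E (sqrtDelta * (zeta - zeta^-1)) by apply: adjoin_gen; right.
  clearbody E; apply: adjoin_sub => // z /rootP [j ->].
  (* The recurrence in [j] leaves only [theta 1] to be placed in [E]. *)
  apply: twisted_sum_subfield => //.
  have [s Es [s0 eqs]] := quotient_sqrtDelta E fE QE E0.
  (* [theta 1] is half the sum of [theta 1 + theta p.-1] and [theta 1 - theta p.-1]. *)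
  have -> : beta * zeta + beta1 / zeta =
      ((beta + beta1) * (zeta + zeta^-1) +
       sqrtDelta * (zeta - zeta^-1) / s) / 2%:R.
    by rewrite -eqs; field; rewrite s0 z0 two0.
  apply: subfield_div => //.
    by apply: subfieldD => //; [apply: subfieldM | apply: subfield_div].
  by rewrite mulr2n; apply: subfieldD => //; apply: subfield1.
(* Reverse inclusion: the sum and difference of the roots [theta 1] and [theta p.-1] yield the two
   generators. *)
set L := splitting_field _ _.
have fL : divring_closed [in L] by apply: adjoin_subfield.
have QL : range iota `<=` L by apply: adjoin_base.
have Ltheta j : L (theta j) by apply: adjoin_gen; apply/rootP; exists j.
have L0 : L (beta + beta1).
  by have := Ltheta 0%N; rewrite /theta expr0 divr1 mulr1.
have L1 : L (beta * zeta + beta1 / zeta) by have := Ltheta 1%N.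
have Lm1 : L (beta / zeta + beta1 * zeta).
  by have := Ltheta p.-1; rewrite /theta zetaV invrK.
have [s Ls [s0 eqs]] := quotient_sqrtDelta L fL QL L0.
clearbody L; apply: adjoin_sub => //; first by apply: adjoin_sub => // z ->.
move=> z [] ->.
  have -> : zeta + zeta^-1 =
      ((beta * zeta + beta1 / zeta) + (beta / zeta + beta1 * zeta)) /
      (beta + beta1) by field; rewrite z0 theta0.
  by apply: subfield_div => //; apply: subfieldD.
have -> : sqrtDelta * (zeta - zeta^-1) =
    ((beta * zeta + beta1 / zeta) - (beta / zeta + beta1 * zeta)) * s.
  by rewrite -eqs; field.
by apply: subfieldM => //; apply: subfieldB.
Qed.
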